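(* Let $(X,d)$ be a nonempty metric space, and let $f_0,f_1:X\to X$ be maps satisfying $$d(x,y)=\max\{d(f_0(x),f_0(y)),\,d(f_1(x),f_1(y))\}$$ for all $x,y\in X$. For each $\beta\in\Sigma$, define $$\rho_\beta(x,y):=\lim_{n\to\infty}d(f_{\beta|n}(x),f_{\beta|n}(y)).$$ Then (the limit exists and) each $\rho_\beta$ is a pseudometric on $X$, and $$d(x,y)=\sup_{\beta\in\Sigma}\rho_\beta(x,y)$$ for all $x,y\in X$.
   Context: $\Sigma:=\{0,1\}^{\mathbb N}$ is the set of infinite binary sequences. For $\beta=(\beta_1,\beta_2,\dots)\in\Sigma$, $\beta|0:=\emptyset$ is the empty word and $\beta|n:=\beta_1\cdots\beta_n$ for $n\geq1$. For finite binary words, $f_\emptyset:=\operatorname{id}_X$ and $f_w:=f_{i_n}\circ\cdots\circ f_{i_1}$ for $w=i_1\cdots i_n$. *)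

(* Defs.v *)
From HB Require Import structures.
From mathcomp Require Import all_boot all_order all_algebra.
From mathcomp Require Import all_classical all_reals all_analysis.
Set Implicit Arguments.
Unset Strict Implicit.
Unset Printing Implicit Defensive.
Import Order.TTheory GRing.Theory Num.Theory.
Import numFieldNormedType.Exports.
Local Open Scope classical_set_scope.
Local Open Scope ring_scope.

(* The digits 0 and 1 are encoded as false and true; the first digit of the
   sequence is beta 0. *)
Definition binseq := nat -> bool.

Definition prefix_word (beta : binseq) (n : nat) : seq bool := mkseq beta n.

(* The first letter of the word is applied first:
   f_{i_1 ... i_n} = f_{i_n} \o ... \o f_{i_1}. *)
Fixpoint word_map (X : Type) (f0 f1 : X -> X) (w : seq bool) : X -> X :=
  if w is i :: w' then word_map f0 f1 w' \o (if i then f1 else f0) else id.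

Definition rho_seq (R : realType) (X : metricType R) (f0 f1 : X -> X)
    (beta : binseq) (x y : X) : R^nat :=
  fun n => mdist (word_map f0 f1 (prefix_word beta n) x)
                 (word_map f0 f1 (prefix_word beta n) y).

Definition rho (R : realType) (X : metricType R) (f0 f1 : X -> X)
    (beta : binseq) (x y : X) : R :=
  lim (rho_seq f0 f1 beta x y n @[n --> \oo]).

(* The library's pseudoMetricType is presented by balls, with no distance
   function. *)
Record is_pseudometric (R : realType) (X : Type) (rho : X -> X -> R) : Prop :=
  IsPseudometric {
    pseudometric_ge0 : forall x y, 0 <= rho x y;
    pseudometric_xx : forall x, rho x x = 0;
    pseudometric_sym : forall x y, rho x y = rho y x;
    pseudometric_triangle : forall x y z, rho x z <= rho x y + rho y z }.

(* Main.v *)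
Require Import Defs.
From HB Require Import structures.
From mathcomp Require Import all_boot all_order all_algebra.
From mathcomp Require Import all_classical all_reals all_analysis.
Set Implicit Arguments.
Unset Strict Implicit.
Unset Printing Implicit Defensive.
Import Order.TTheory GRing.Theory Num.Theory.
Import numFieldNormedType.Exports.
Local Open Scope classical_set_scope.
Local Open Scope ring_scope.

(** Let [d] be the distance.  The hypothesis says that each of [f0], [f1] is
    1-Lipschitz and that every pair of points keeps its distance under at least
    one of them.

    By the first half, [d (f_(beta|n) x) (f_(beta|n) y)] is nonincreasing in [n]
    and bounded below by 0, so it converges, to a limit at most [d x y]; every
    term is a pseudometric in [(x, y)], and these axioms are closed conditions,
    hence pass to the limit.

    By the second half, starting from [(x, y)] one may choose at each step a
    digit whose map preserves the distance of the current pair.  Along the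
    sequence of these digits the distances are constantly [d x y], so the
    supremum over all sequences is attained ([exists_rho_eq_mdist]). *)

Lemma word_map_rcons (X : Type) (f0 f1 : X -> X) (w : seq bool) (i : bool) :
  word_map f0 f1 (rcons w i) = (if i then f1 else f0) \o word_map f0 f1 w.
Proof. by elim: w => [|j w IHw] //=; rewrite IHw. Qed.

Lemma word_map_prefixS (X : Type) (f0 f1 : X -> X) (beta : binseq) (n : nat) :
  word_map f0 f1 (prefix_word beta n.+1) =
  (if beta n then f1 else f0) \o word_map f0 f1 (prefix_word beta n).
Proof. by rewrite /prefix_word mkseqS word_map_rcons. Qed.

Section Limits.
Variables (R : realType) (X : metricType R) (f0 f1 : X -> X).
Hypothesis f_max : forall x y : X,
  mdist x y = Num.max (mdist (f0 x) (f0 y)) (mdist (f1 x) (f1 y)).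

Lemma digit_map_lipschitz (i : bool) (x y : X) :
  mdist ((if i then f1 else f0) x) ((if i then f1 else f0) y) <= mdist x y.
Proof. by rewrite (f_max x y) le_max; case: i; rewrite lexx ?orbT. Qed.

Lemma rho_seq_nonincreasing (beta : binseq) (x y : X) :
  {homo rho_seq f0 f1 beta x y : n m / (n <= m)%N >-> m <= n}.
Proof.
apply/nonincreasing_seqP => n.
by rewrite /rho_seq word_map_prefixS /=; exact: digit_map_lipschitz.
Qed.

Lemma is_cvg_rho_seq (beta : binseq) (x y : X) :
  cvg (rho_seq f0 f1 beta x y n @[n --> \oo]).
Proof.
apply: nonincreasing_is_cvgn; first exact: rho_seq_nonincreasing.
by exists 0 => _ [n _ <-]; exact: mdist_ge0.
Qed.

Lemma rho_le_mdist (beta : binseq) (x y : X) :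
  rho f0 f1 beta x y <= mdist x y.
Proof.
(* The distance itself is the term of index 0, for the empty prefix. *)
exact: (nonincreasing_cvgn_ge (@rho_seq_nonincreasing beta x y)
                              (@is_cvg_rho_seq beta x y) 0%N).
Qed.

Lemma rho_is_pseudometric (beta : binseq) : is_pseudometric (rho f0 f1 beta).
Proof.
split=> [x y|x|x y|x y z].
- apply: limr_ge; first exact: is_cvg_rho_seq.
  by apply: nearW => n; exact: mdist_ge0.
- rewrite /rho (_ : rho_seq f0 f1 beta x x = fun=> 0); first exact: lim_cst.
  by apply/funext => n; exact: mdistxx.
- rewrite /rho (_ : rho_seq f0 f1 beta x y = rho_seq f0 f1 beta y x) //.
  by apply/funext => n; exact: metric_sym.
- rewrite /rho -limD; [|exact: is_cvg_rho_seq|exact: is_cvg_rho_seq].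
  apply: ler_lim; first exact: is_cvg_rho_seq.
  + by apply: is_cvgD; exact: is_cvg_rho_seq.
  + by apply: nearW => n; exact: metric_triangle.
Qed.

(** The digit 0 is preferred: 1 is chosen exactly when [f0] shrinks the
    distance, and then [f1] must realize the maximum. *)
Definition preserving_digit (p : X * X) : bool :=
  mdist (f0 p.1) (f0 p.2) != mdist p.1 p.2.

Lemma mdist_preserving_digit (p : X * X) :
  let g := if preserving_digit p then f1 else f0 in
  mdist (g p.1) (g p.2) = mdist p.1 p.2.
Proof.
rewrite /preserving_digit; case: eqP => //= d0; move: d0.
by rewrite (f_max p.1 p.2); case: leP.
Qed.

Definition preserving_step (p : X * X) : X * X :=
  let g := if preserving_digit p then f1 else f0 in (g p.1, g p.2).

Definition preserving_seq (x y : X) : binseq :=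
  fun n => preserving_digit (iter n preserving_step (x, y)).

(** The digits are read off an orbit of pairs, rather than defined from the
    prefix already chosen, which avoids a recursion on words; this lemma
    identifies that orbit with the images under the prefix maps. *)
Lemma iter_preserving_step (x y : X) (n : nat) :
  iter n preserving_step (x, y) =
  (word_map f0 f1 (prefix_word (preserving_seq x y) n) x,
   word_map f0 f1 (prefix_word (preserving_seq x y) n) y).
Proof.
elim: n => [//|n IHn]; rewrite iterS word_map_prefixS /=.
by rewrite /preserving_step -/(preserving_seq x y n) IHn.
Qed.

Lemma rho_seq_preserving_seq (x y : X) :
  rho_seq f0 f1 (preserving_seq x y) x y = fun=> mdist x y.
Proof.
apply/funext; elim=> [//|n IHn].
rewrite -[RHS]IHn /rho_seq word_map_prefixS /=.
have /= := mdist_preserving_digit (iter n preserving_step (x, y)).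
by rewrite -/(preserving_seq x y n) iter_preserving_step.
Qed.

Lemma exists_rho_eq_mdist (x y : X) :
  exists beta : binseq, rho f0 f1 beta x y = mdist x y.
Proof.
exists (preserving_seq x y).
by rewrite /rho rho_seq_preserving_seq; exact: lim_cst.
Qed.

End Limits.

(* Since sup is 0 on sets without a supremum, the last clause also asserts
   has_sup. *)
Theorem lemma4p70 (R : realType) (X : metricType R)
    (X_nonempty : [set: X] !=set0) (f0 f1 : X -> X)
    (f_max : forall x y : X,
      mdist x y = Num.max (mdist (f0 x) (f0 y)) (mdist (f1 x) (f1 y))) :
  [/\ forall (beta : binseq) (x y : X),
        cvg (rho_seq f0 f1 beta x y n @[n --> \oo]),
      forall beta : binseq, is_pseudometric (rho f0 f1 beta)
    & forall x y : X,
        has_sup [set rho f0 f1 beta x y | beta in [set: binseq]] /\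
        mdist x y = sup [set rho f0 f1 beta x y | beta in [set: binseq]]].
Proof.
split=> [beta x y|beta|x y]; first exact: is_cvg_rho_seq.
  exact: rho_is_pseudometric.
set E := [set _ | _ in _].
have ubE : ubound E (mdist x y) by move=> _ [beta _ <-]; exact: rho_le_mdist.
have Ed : E (mdist x y).
  by have [beta rhoE] := exists_rho_eq_mdist f_max x y; exists beta.
split; first by split; exists (mdist x y).
apply/eqP; rewrite eq_le ge_sup ?andbT; [|by exists (mdist x y)|exact: ubE].
by apply: ub_le_sup => //; exists (mdist x y).
Qed.
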